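(* Let $(\mathbf{i}_\beta)_{\beta=0,\dots,3}$ be a canonical basis of the real quaternion algebra $\mathbb{H}$, and let $(w,x,y,z)$ be the corresponding canonical coordinates on the Lie group $\mathcal{H}^{\circ}=\mathbb{H}\setminus\{0\}$ of nonzero quaternions. Let $\mathbf{u}\in\mathbb{H}$ have components $(u^0,u^1,u^2,u^3)$ in $(\mathbf{i}_\beta)$, and let $a\in\mathcal{H}^{\circ}$ have coordinates $(\bar w,\bar x,\bar y,\bar z)$. Then the $(\mathbf{u},a)$-vista, i.e. the integral curve through $a$ of the left invariant vector field on $\mathcal{H}^{\circ}$ generated by $\mathbf{u}$, can be computed by solving the system of differential equations (with parameter $t$) determined by that vector field: $$w(t)=\exp(u^0t)\Big(\frac{-u^1\bar x-u^2\bar y-u^3\bar z}{\omega}\sin\omega t+\bar w\cos\omega t\Big),$$ $$x(t)=\exp(u^0t)\Big(\frac{u^1\bar w-u^2\bar z+u^3\bar y}{\omega}\sin\omega t+\bar x\cos\omega t\Big),$$ $$y(t)=\exp(u^0t)\Big(\frac{u^1\bar z+u^2\bar w-u^3\bar x}{\omega}\sin\omega t+\bar y\cos\omega t\Big),$$ $$z(t)=\exp(u^0t)\Big(\frac{-u^1\bar y+u^2\bar x+u^3\bar w}{\omega}\sin\omega t+\bar z\cos\omega t\Big),$$ where $\omega:=\sqrt{(u^1)^2+(u^2)^2+(u^3)^2}$.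
   Context: A canonical basis of $\mathbb{H}$ is a basis $(\mathbf{i}_0,\mathbf{i}_1,\mathbf{i}_2,\mathbf{i}_3)$ with the standard quaternion multiplication table: $\mathbf{i}_0$ is the identity, $\mathbf{i}_1^2=\mathbf{i}_2^2=\mathbf{i}_3^2=-\mathbf{i}_0$, $\mathbf{i}_1\mathbf{i}_2=-\mathbf{i}_2\mathbf{i}_1=\mathbf{i}_3$, and cyclically. The canonical coordinates $(w,x,y,z)$ of $a$ are the components of the quaternion $a$ in this basis. The tangent space $T_a\mathcal{H}^{\circ}$ is identified with $\mathbb{H}$ in the usual way (open subset of a vector space). The left invariant vector field $\hat{\mathbf{u}}$ generated by $\mathbf{u}\in\mathbb{H}$ is $\hat{\mathbf{u}}(a)=a\mathbf{u}$ (quaternion product); at the point with coordinates $(w,x,y,z)$ its components in $(\partial_w,\partial_x,\partial_y,\partial_z)$ are $\hat u^0=wu^0-xu^1-yu^2-zu^3$, $\hat u^1=wu^1+xu^0+yu^3-zu^2$, $\hat u^2=wu^2-xu^3+yu^0+zu^1$, $\hat u^3=wu^3+xu^2-yu^1+zu^0$. The system of differential equations is $\dot w=\hat u^0$, $\dot x=\hat u^1$, $\dot y=\hat u^2$, $\dot z=\hat u^3$. *)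

(* Defs.v *)
From HB Require Import structures.
From mathcomp Require Import all_boot all_order all_algebra all_field.
From mathcomp Require Import all_classical all_reals all_analysis.

Set Implicit Arguments.
Unset Strict Implicit.
Unset Printing Implicit Defensive.

Import Order.TTheory GRing.Theory Num.Theory.
Import numFieldNormedType.Exports.

Local Open Scope classical_set_scope.
Local Open Scope ring_scope.

(* The quaternion algebra is taken up to isomorphism: it is a finite-dimensional
   associative unital algebra over the reals having a canonical basis. *)
Definition canonical_basis (R : realType) (H : falgType R) (i : 4.-tuple H) : Prop :=
  [/\ basis_of fullv i, i`_0 = 1,
      [/\ i`_1 * i`_1 = - i`_0, i`_2 * i`_2 = - i`_0 & i`_3 * i`_3 = - i`_0],
      [/\ i`_1 * i`_2 = i`_3, i`_2 * i`_3 = i`_1 & i`_3 * i`_1 = i`_2] &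
      [/\ i`_2 * i`_1 = - i`_3, i`_3 * i`_2 = - i`_1 & i`_1 * i`_3 = - i`_2] ].

(* Derivative of a curve in a finite-dimensional real vector space V. A bare
   vectType carries no topology; it is transported from R^(dim V) along the
   linear isomorphism v2r. All linear isomorphisms with R^(dim V) give the same
   notion, so nothing depends on the choice of v2r. *)
Definition has_velocity (R : realType) (V : vectType R) (c : R -> V) (t : R)
    (v : V) : Prop :=
  is_derive t (1 : R) (fun s : R => VectorInternalTheory.v2r (c s))
    (VectorInternalTheory.v2r v).

Definition left_invariant_field (R : realType) (H : falgType R) (u : H) : H -> H :=
  fun a => a * u.

(* Integral curve, with parameter domain J, of a vector field on the open
   submanifold of nonzero elements; the values of c outside J are irrelevant
   when J is open. *)
Definition is_integral_curve (R : realType) (H : falgType R) (X : H -> H)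
    (J : set R) (c : R -> H) : Prop :=
  forall t, J t -> c t != 0 /\ has_velocity c t (X (c t)).

(* The integral curve through a is normalised by c 0 = a. *)
Definition is_vista_on (R : realType) (H : falgType R) (u a : H)
    (J : set R) (c : R -> H) : Prop :=
  is_integral_curve (left_invariant_field u) J c /\ c 0 = a.

Definition solves_vista_system (R : realType) (u0 u1 u2 u3 : R) (J : set R)
    (w x y z : R -> R) : Prop :=
  forall t, J t ->
  [/\ is_derive t (1 : R) w (w t * u0 - x t * u1 - y t * u2 - z t * u3),
      is_derive t (1 : R) x (w t * u1 + x t * u0 + y t * u3 - z t * u2),
      is_derive t (1 : R) y (w t * u2 - x t * u3 + y t * u0 + z t * u1) &
      is_derive t (1 : R) z (w t * u3 + x t * u2 - y t * u1 + z t * u0)].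

(* Main.v *)
Require Import Defs.
From HB Require Import structures.
From mathcomp Require Import all_boot all_order all_algebra all_field.
From mathcomp Require Import all_classical all_reals all_analysis.
From mathcomp Require Import ring.

Set Implicit Arguments.
Unset Strict Implicit.
Unset Printing Implicit Defensive.

Import Order.TTheory GRing.Theory Num.Theory.
Import numFieldNormedType.Exports.
Import VectorInternalTheory.

Local Open Scope classical_set_scope.
Local Open Scope ring_scope.

(** In canonical coordinates, the derivative of a curve is taken componentwise
and right multiplication by u is given by the multiplication table, so the vista
equation is the linear system. A solution p of this linear system satisfies
(|p|^2)' = 2 u^0 |p|^2, because right multiplication by the pure part of u is
skew-symmetric; hence exp(-2 u^0 t) |p|^2 is constant. Applied to the formulas,
this shows that they never vanish; applied to the difference of two solutions,
it gives uniqueness. *)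

(** * Derivatives of curves, taken in coordinates *)

Lemma is_derive_rowP (R : realFieldType) n (M : R -> 'rV[R]_n) (t : R) v :
  is_derive t 1 M v <->
  forall j, is_derive t 1 (fun s => M s 0 j) (v 0 j).
Proof.
split=> [[Mt Mv] j|Mt].
  split; first exact: (derivable_mxP _ _ _).1.
  by rewrite -Mv derive_mx// mxE.
have dM : derivable M t 1 by apply/derivable_mxP => i j; rewrite ord1; case: (Mt j).
split=> //; rewrite derive_mx//; apply/matrixP => i j.
by rewrite mxE ord1; case: (Mt j).
Qed.

Lemma is_derive_lincomb (R : realFieldType) n (k : 'I_n -> R) (f : 'I_n -> R -> R)
    (t : R) (df : 'I_n -> R) :
  (forall j, is_derive t 1 (f j) (df j)) ->
  is_derive t 1 (fun s => \sum_(j < n) f j s * k j) (\sum_(j < n) df j * k j).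
Proof.
move=> fdf; rewrite -fct_sumE; apply: is_derive_sum => j.
rewrite mulrC (_ : (fun _ => _) = k j *: f j); first exact: is_deriveZ.
by apply/funext => s /=; rewrite mulrC.
Qed.

(** The coordinates in [b] and those given by [v2r] are linear combinations of each other with
    constant coefficients, so derivatives pass both ways. *)
Lemma has_velocity_coordP (R : realType) (V : vectType R) n (b : n.-tuple V)
    (c : R -> V) (t : R) (v : V) : basis_of fullv b ->
  has_velocity c t v <->
  forall k, is_derive t 1 (fun s => coord b k (c s)) (coord b k v).
Proof.
move=> bb; rewrite /has_velocity is_derive_rowP; split => ct j.
  have coordE x :
      coord b j x = \sum_k v2r x 0 k * coord b j (r2v (delta_mx 0 k)).
    rewrite -{1}[x]v2rK {1}(row_sum_delta (v2r x)) !linear_sum/=.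
    by apply: eq_bigr => k _; rewrite !linearZ.
  by rewrite coordE; under eq_fun do rewrite coordE; exact: is_derive_lincomb.
have v2rE x : v2r x 0 j = \sum_k coord b k x * v2r b`_k 0 j.
  rewrite {1}(coord_basis bb (memvf x)) linear_sum summxE/=.
  by apply: eq_bigr => k _; rewrite linearZ mxE.
by rewrite v2rE; under eq_fun do rewrite v2rE; exact: is_derive_lincomb.
Qed.

(** Mean value theorem on the segment from [s] to [t], which lies in [J]. *)
Lemma is_derive0_itv_cst (R : realType) (J : set R) (f : R -> R) :
  is_interval J -> (forall t, J t -> is_derive t 1 f 0) ->
  forall s t, J s -> J t -> f s = f t.
Proof.
move=> Jitv df s t; wlog st : s t / s <= t.
  by move=> H Js Jt; case: (leP s t) => [/H ->//|/ltW/H ->].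
move=> Js Jt; have inJ r : r \in `[s, t] -> J r.
  by rewrite in_itv/=; exact: Jitv.
have [r||_ _] := @MVT_segment R f (fun=> 0) s t st.
- by move=> rst; apply: df; apply: inJ; exact: subset_itv_oo_cc.
- by apply: derivable_within_continuous => r /inJ /df[].
- by rewrite mul0r => /eqP; rewrite subr_eq0 => /eqP.
Qed.

(** * The linear system: squared norm and linearity *)

Section system.
Variables (R : realType) (u0 u1 u2 u3 : R).
Implicit Types (J : set R) (w x y z : R -> R).

Lemma vista_system_energy J w x y z : is_interval J -> J 0 ->
  solves_vista_system u0 u1 u2 u3 J w x y z ->
  forall t, J t -> w t ^+ 2 + x t ^+ 2 + y t ^+ 2 + z t ^+ 2 =
    expR (2 * u0 * t) * (w 0 ^+ 2 + x 0 ^+ 2 + y 0 ^+ 2 + z 0 ^+ 2).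
Proof.
move=> Jitv J0 sys t Jt.
pose E s := expR (- (2 * u0) * s) * (w s ^+ 2 + x s ^+ 2 + y s ^+ 2 + z s ^+ 2).
have dE s : J s -> is_derive s 1 E 0.
  move=> /sys[dw dx dy dz]; rewrite /E.
  (* The terms in [u1], [u2], [u3] cancel in pairs; those in [u0] cancel against the derivative of
     the exponential. *)
  by apply: is_derive_eq; rewrite /GRing.scale/=; ring.
have := is_derive0_itv_cst Jitv dE J0 Jt.
rewrite /E mulr0 expR0 mul1r => ->.
by rewrite mulrA -expRD mulNr subrr expR0 mul1r.
Qed.

Lemma vista_system_sub J w x y z w' x' y' z' :
  solves_vista_system u0 u1 u2 u3 J w x y z ->
  solves_vista_system u0 u1 u2 u3 J w' x' y' z' ->
  solves_vista_system u0 u1 u2 u3 J (w - w') (x - x') (y - y') (z - z').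
Proof.
move=> sys sys' t Jt; have [dw dx dy dz] := sys t Jt.
have [dw' dx' dy' dz'] := sys' t Jt.
by split; apply: is_derive_eq; rewrite !fctE; ring.
Qed.

End system.

(** * Quaternion product and vista equation in canonical coordinates *)

Section quaternion.
Variables (R : realType) (H : falgType R) (i : 4.-tuple H).
Hypothesis hi : canonical_basis i.

Lemma canonical_basisE (c : H) :
  c = coord i 0 c *: i`_0 + coord i 1 c *: i`_1
    + coord i 2 c *: i`_2 + coord i 3 c *: i`_3.
Proof.
have [ib _ _ _ _] := hi.
(* [big_ord_recl] produces iterated lifts; they are turned back into numerals. *)
have l1 : lift ord0 ord0 = 1 :> 'I_4 by exact: val_inj.
have l2 : lift ord0 (lift ord0 ord0) = 2 :> 'I_4 by exact: val_inj.
have l3 : lift ord0 (lift ord0 (lift ord0 ord0)) = 3 :> 'I_4 by exact: val_inj.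
rewrite {1}(coord_basis ib (memvf c)) !big_ord_recl big_ord0 l1 l2 l3.
by rewrite addr0 !addrA.
Qed.

Lemma coord_canonical (c0 c1 c2 c3 : R)
    (c := c0 *: i`_0 + c1 *: i`_1 + c2 *: i`_2 + c3 *: i`_3) :
  [/\ coord i 0 c = c0, coord i 1 c = c1, coord i 2 c = c2 & coord i 3 c = c3].
Proof.
have [/basis_free ifree _ _ _ _] := hi.
have ci (m k : 'I_4) : coord i k i`_m = (m == k)%:R by exact: coord_free.
(* With the first index fixed, the ordinals reduce to numerals, and the tuple serves as one rewrite
   rule. *)
have := (ci 0, ci 1, ci 2, ci 3) => /= {}ci.
by split; rewrite /c !linearD !linearZ/= !ci/= ?(mulr1, mulr0, addr0, add0r).
Qed.

(** By bilinearity only the sixteen products of basis vectors matter, and these are read off the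
    multiplication table. For [b] equal to [u] this gives the components of the left invariant
    field. *)
Lemma coord_mul (a b : H) :
  let a0 := coord i 0 a in let a1 := coord i 1 a in
  let a2 := coord i 2 a in let a3 := coord i 3 a in
  let b0 := coord i 0 b in let b1 := coord i 1 b in
  let b2 := coord i 2 b in let b3 := coord i 3 b in
  [/\ coord i 0 (a * b) = a0 * b0 - a1 * b1 - a2 * b2 - a3 * b3,
      coord i 1 (a * b) = a0 * b1 + a1 * b0 + a2 * b3 - a3 * b2,
      coord i 2 (a * b) = a0 * b2 - a1 * b3 + a2 * b0 + a3 * b1 &
      coord i 3 (a * b) = a0 * b3 + a1 * b2 - a2 * b1 + a3 * b0].
Proof.
move=> a0 a1 a2 a3 b0 b1 b2 b3.
have [/basis_free ifree i0 [i11 i22 i33] [i12 i23 i31] [i21 i32 i13]] := hi.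
have ci (m k : 'I_4) : coord i k i`_m = (m == k)%:R by exact: coord_free.
have := (ci 0, ci 1, ci 2, ci 3) => /= {}ci.
have i0l x : i`_0 * x = x by rewrite i0 mul1r.
have i0r x : x * i`_0 = x by rewrite i0 mulr1.
rewrite (canonical_basisE a) (canonical_basisE b).
rewrite -/a0 -/a1 -/a2 -/a3 -/b0 -/b1 -/b2 -/b3.
rewrite !(mulrDl, mulrDr) -!(scalerAl, scalerAr) !i0l !i0r.
rewrite i11 i22 i33 i12 i23 i31 i21 i32 i13.
split; rewrite !(linearD, linearN, linearZ)/= !ci/= /GRing.scale/=; ring.
Qed.

(** The linear system does not see the origin, so staying in the group is a separate assumption on
    [c]. *)
Lemma vista_systemP (u a : H) (J : set R) (c : R -> H) :
  (forall t, J t -> c t != 0) ->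
  is_vista_on u a J c <->
  solves_vista_system (coord i 0 u) (coord i 1 u) (coord i 2 u) (coord i 3 u) J
    (fun t => coord i 0 (c t)) (fun t => coord i 1 (c t))
    (fun t => coord i 2 (c t)) (fun t => coord i 3 (c t)) /\ c 0 = a.
Proof.
move=> c0; have [ib _ _ _ _] := hi.
rewrite /is_vista_on /is_integral_curve /left_invariant_field.
split=> -[ode c0a]; split=> // t Jt.
  have [_ /(has_velocity_coordP _ _ _ ib) dc] := ode t Jt.
  have [<- <- <- <-] := coord_mul (c t) u.
  by split; exact: dc.
split; first exact: c0.
apply/(has_velocity_coordP _ _ _ ib) => k.
have := ode t Jt; have [<- <- <- <-] := coord_mul (c t) u => -[d0 d1 d2 d3].
case: k => -[|[|[|[|//]]]] k4.
- by rewrite (_ : Ordinal k4 = 0)//; exact: val_inj.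
- by rewrite (_ : Ordinal k4 = 1)//; exact: val_inj.
- by rewrite (_ : Ordinal k4 = 2)//; exact: val_inj.
- by rewrite (_ : Ordinal k4 = 3)//; exact: val_inj.
Qed.

End quaternion.

(** * The explicit solution *)

Definition vista_formula (R : realType) (u0 omega p q t : R) : R :=
  expR (u0 * t) * (p / omega * sin (omega * t) + q * cos (omega * t)).

(** The factor [omega / omega] is kept, since [omega] may be 0. *)
Lemma is_derive_vista_formula (R : realType) (u0 omega p q t : R) :
  is_derive t (1 : R) (vista_formula u0 omega p q)
    (u0 * vista_formula u0 omega p q t + expR (u0 * t) *
      (p * omega / omega * cos (omega * t) - q * omega * sin (omega * t))).
Proof.
by rewrite /vista_formula; apply: is_derive_eq; rewrite /GRing.scale/=; ring.
Qed.

(** Right multiplication by the pure part v of u squares to the scalar [- omega ^+ 2]. The sine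
    coefficients, before division by [omega], are the coordinates of a v, so for nonzero [omega] the
    four functions are the coordinates of a exp(t u). *)
Lemma vista_formula_system (R : realType) (u0 u1 u2 u3 wb xb yb zb : R) :
  let f := vista_formula u0 (Num.sqrt (u1 ^+ 2 + u2 ^+ 2 + u3 ^+ 2)) in
  solves_vista_system u0 u1 u2 u3 setT
    (f (- u1 * xb - u2 * yb - u3 * zb) wb) (f (u1 * wb - u2 * zb + u3 * yb) xb)
    (f (u1 * zb + u2 * wb - u3 * xb) yb) (f (- u1 * yb + u2 * xb + u3 * wb) zb).
Proof.
set omega := Num.sqrt _ => f.
have omega2 : omega ^+ 2 = u1 ^+ 2 + u2 ^+ 2 + u3 ^+ 2.
  by rewrite sqr_sqrtr// !addr_ge0 ?sqr_ge0.
(* For omega = 0 all the u_k vanish, so this also holds with the convention x / 0 = 0. *)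
have omegaK v : v ^+ 2 <= omega ^+ 2 -> v * omega / omega = v.
  have [->|o0 _] := eqVneq omega 0; last by rewrite mulfK.
  by rewrite expr0n/= real_exprn_even_le0//= => /eqP->; rewrite !mul0r.
have e1 : u1 * omega / omega = u1.
  by apply: omegaK; rewrite omega2 -addrA lerDl addr_ge0 ?sqr_ge0.
have e2 : u2 * omega / omega = u2.
  by apply: omegaK; rewrite omega2 addrAC lerDr addr_ge0 ?sqr_ge0.
have e3 : u3 * omega / omega = u3.
  by apply: omegaK; rewrite omega2 lerDr addr_ge0 ?sqr_ge0.
have e : (u1 ^+ 2 + u2 ^+ 2 + u3 ^+ 2) / omega = omega.
  by rewrite -omega2 expr2 omegaK.
(* [ring] cannot cancel [omega] against its inverse, so the equations are proved modulo [e1], [e2],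
   [e3] and [e], with explicit multipliers. *)
have comb c1 c2 c3 c l r : l - r = c1 * (u1 * omega / omega - u1)
    + c2 * (u2 * omega / omega - u2) + c3 * (u3 * omega / omega - u3)
    + c * ((u1 ^+ 2 + u2 ^+ 2 + u3 ^+ 2) / omega - omega) -> l = r.
  rewrite e1 e2 e3 e !subrr !mulr0 !addr0 => /eqP.
  by rewrite subr_eq0 => /eqP.
move=> t _; split; apply: is_derive_eq (is_derive_vista_formula _ _ _ _ _) _;
  rewrite /f /vista_formula; set E := expR _; set S := sin _; set C := cos _.
(* The first three multipliers come from the cosine terms of the derivative; the last comes from the
   sine terms and carries the initial value. *)
- by apply: (comb (- xb * E * C) (- yb * E * C) (- zb * E * C) (wb * E * S)); ring.
- by apply: (comb (wb * E * C) (- zb * E * C) (yb * E * C) (xb * E * S)); ring.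
- by apply: (comb (zb * E * C) (wb * E * C) (- xb * E * C) (yb * E * S)); ring.
- by apply: (comb (- yb * E * C) (xb * E * C) (wb * E * C) (zb * E * S)); ring.
Qed.

(** * Existence and uniqueness of the vista *)

Lemma sum_sqr4_eq0 (R : realDomainType) (w x y z : R) :
  w ^+ 2 + x ^+ 2 + y ^+ 2 + z ^+ 2 = 0 -> [/\ w = 0, x = 0, y = 0 & z = 0].
Proof.
move=> /eqP; rewrite !paddr_eq0 ?addr_ge0 ?sqr_ge0// !sqrf_eq0.
by move=> /andP[/andP[/andP[/eqP-> /eqP->] /eqP->] /eqP->].
Qed.

Theorem mainTheorem1 (R : realType) (H : falgType R) (i : 4.-tuple H)
    (hi : canonical_basis i) (u a : H) (ha : a != 0) :
  let u0 := coord i 0 u in let u1 := coord i 1 u in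
  let u2 := coord i 2 u in let u3 := coord i 3 u in
  let wb := coord i 0 a in let xb := coord i 1 a in
  let yb := coord i 2 a in let zb := coord i 3 a in
  let omega := Num.sqrt (u1 ^+ 2 + u2 ^+ 2 + u3 ^+ 2) in
  let w := fun t : R => expR (u0 * t) *
    ((- u1 * xb - u2 * yb - u3 * zb) / omega * sin (omega * t)
     + wb * cos (omega * t)) in
  let x := fun t : R => expR (u0 * t) *
    ((u1 * wb - u2 * zb + u3 * yb) / omega * sin (omega * t)
     + xb * cos (omega * t)) in
  let y := fun t : R => expR (u0 * t) *
    ((u1 * zb + u2 * wb - u3 * xb) / omega * sin (omega * t)
     + yb * cos (omega * t)) in
  let z := fun t : R => expR (u0 * t) *
    ((- u1 * yb + u2 * xb + u3 * wb) / omega * sin (omega * t)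
     + zb * cos (omega * t)) in
  [/\ (* being the vista amounts to solving the system in coordinates *)
      forall (J : set R) (c : R -> H), open J -> is_interval J -> J 0 ->
        (forall t, J t -> c t != 0) ->
        (is_vista_on u a J c <->
         solves_vista_system u0 u1 u2 u3 J
           (fun t => coord i 0 (c t)) (fun t => coord i 1 (c t))
           (fun t => coord i 2 (c t)) (fun t => coord i 3 (c t)) /\
         c 0 = a),
      (* the formulas define the vista, for all values of the parameter *)
      is_vista_on u a setT
        (fun t => w t *: i`_0 + x t *: i`_1 + y t *: i`_2 + z t *: i`_3) &
      (* any integral curve through a is given by the formulas *)
      forall (J : set R) (c : R -> H), open J -> is_interval J -> J 0 ->
        is_vista_on u a J c ->
        forall t, J t ->
          [/\ coord i 0 (c t) = w t, coord i 1 (c t) = x t,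
              coord i 2 (c t) = y t & coord i 3 (c t) = z t]].
Proof.
move=> u0 u1 u2 u3 wb xb yb zb omega w x y z.
have sys : solves_vista_system u0 u1 u2 u3 setT w x y z.
  exact: vista_formula_system.
have f0 p q : expR (u0 * 0) * (p / omega * sin (omega * 0) + q * cos (omega * 0)) = q.
  by rewrite !mulr0 expR0 sin0 cos0 mulr0 add0r mul1r mulr1.
have [w0 x0 y0 z0] : [/\ w 0 = wb, x 0 = xb, y 0 = yb & z 0 = zb].
  by rewrite /w /x /y /z !f0.
pose c t := w t *: i`_0 + x t *: i`_1 + y t *: i`_2 + z t *: i`_3.
have cE t : [/\ coord i 0 (c t) = w t, coord i 1 (c t) = x t,
  coord i 2 (c t) = y t & coord i 3 (c t) = z t] by exact: coord_canonical.
split=> [J d _ _ _ d0||J d _ Jitv J0 dvista t Jt].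
- exact: vista_systemP.
- rewrite -[fun t => _]/c; apply/(vista_systemP hi) => [t _|].
    (* A zero at time [t] makes the squared norm of [a] vanish, the exponential factor being
       nonzero. *)
    apply: contraNneq ha => ct0.
    have := vista_system_energy (fun _ _ _ _ _ _ => I) I sys (t := t) I.
    have [<- <- <- <-] := cE t; rewrite ct0 !linear0 w0 x0 y0 z0 expr0n/= !addr0.
    move=> /esym/eqP; rewrite mulf_eq0 expR_eq0/= => /eqP/sum_sqr4_eq0[wb0 xb0 yb0 zb0].
    rewrite (canonical_basisE hi a) -/wb -/xb -/yb -/zb wb0 xb0 yb0 zb0.
    by rewrite !scale0r !addr0.
  split.
    have -> : (fun t => coord i 0 (c t)) = w by apply/funext => s; case: (cE s).
    have -> : (fun t => coord i 1 (c t)) = x by apply/funext => s; case: (cE s).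
    have -> : (fun t => coord i 2 (c t)) = y by apply/funext => s; case: (cE s).
    by have -> : (fun t => coord i 3 (c t)) = z by apply/funext => s; case: (cE s).
  by rewrite /c w0 x0 y0 z0 -canonical_basisE.
have d0 s : J s -> d s != 0 by case: dvista => + _ => /[apply] -[].
have [dsys da] := (vista_systemP hi u a d0).1 dvista.
(* The difference from the formulas, restricted to [J], starts at 0, so its squared norm is 0
   throughout [J]. *)
have := vista_system_energy Jitv J0 (vista_system_sub dsys (fun s _ => sys s I)) Jt.
rewrite !fctE da w0 x0 y0 z0 !subrr expr0n/= !addr0 mulr0 => /sum_sqr4_eq0.
by move=> [/subr0_eq ? /subr0_eq ? /subr0_eq ? /subr0_eq ?].
Qed.
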